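(* Let $X$ and $Y$ be locally compact Hausdorff spaces and let $T\colon C_0^+(X,\mathbb{R})\to C_0^+(Y,\mathbb{R})$ be a surjective phase-isometry. Then there exists a homeomorphism $\phi\colon Y\to X$ such that $T(f)(y)=f(\phi(y))$ holds for all $f\in C_0^+(X,\mathbb{R})$ and $y\in Y$.
   Context: For a locally compact Hausdorff space $L$, $C_0(L,\mathbb{R})$ denotes the real Banach space of all continuous real-valued functions on $L$ vanishing at infinity, equipped with the supremum norm $\|h\|_\infty=\sup_{x\in L}|h(x)|$. Its positive cone is $C_0^+(L,\mathbb{R})=\{h\in C_0(L,\mathbb{R}): h\ge 0\}$. A map $T\colon C_0^+(X,\mathbb{R})\to C_0^+(Y,\mathbb{R})$ (not assumed linear, additive or continuous) is a phase-isometry if the equality of sets $\{\|T(f)+T(g)\|_\infty,\ \|T(f)-T(g)\|_\infty\}=\{\|f+g\|_\infty,\ \|f-g\|_\infty\}$ holds for all $f,g\in C_0^+(X,\mathbb{R})$. *)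

(* Defs.v *)
From HB Require Import structures.
From mathcomp Require Import all_boot all_order all_algebra.
From mathcomp Require Import all_classical all_reals all_analysis.

Set Implicit Arguments.
Unset Strict Implicit.
Unset Printing Implicit Defensive.

Import Order.TTheory GRing.Theory Num.Theory.
Import numFieldNormedType.Exports.

Local Open Scope classical_set_scope.
Local Open Scope ring_scope.

Definition vanishes_at_infinity (L : topologicalType) (R : realType)
    (h : L -> R) : Prop :=
  forall e : R, 0 < e ->
    exists2 K : set L, compact K & forall x, ~ K x -> `|h x| < e.

Definition C0 (L : topologicalType) (R : realType) : set (L -> R) :=
  [set h | continuous h /\ vanishes_at_infinity h].
Arguments C0 L R : clear implicits.

Definition C0_pos (L : topologicalType) (R : realType) : set (L -> R) :=
  [set h | C0 L R h /\ forall x, 0 <= h x].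
Arguments C0_pos L R : clear implicits.

(* The supremum is taken in [R]: functions in [C0] are bounded, and [sup set0]
   is [0], so the norm is also right when [L] is empty. *)
Definition sup_norm (L : topologicalType) (R : realType) (h : L -> R) : R :=
  sup (range (fun x => `|h x|)).

(* A map from [C0_pos X R] to [C0_pos Y R] is, as for [set_fun] and [set_surj],
   a function on [X -> R] whose values outside [C0_pos X R] are irrelevant. *)
Definition phase_isometry (X Y : topologicalType) (R : realType)
    (T : (X -> R) -> (Y -> R)) : Prop :=
  forall f g : X -> R, C0_pos X R f -> C0_pos X R g ->
    [set sup_norm (T f + T g); sup_norm (T f - T g)] =
    [set sup_norm (f + g); sup_norm (f - g)].

Definition homeomorphism (Y X : topologicalType) (phi : Y -> X) : Prop :=
  exists psi : X -> Y,
    [/\ cancel phi psi, cancel psi phi, continuous phi & continuous psi].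

(* Main.v *)
Require Import Defs.
From HB Require Import structures.
From mathcomp Require Import all_boot all_order all_algebra.
From mathcomp Require Import all_classical all_reals all_analysis.
From mathcomp Require Import lra.

Import Order.TTheory GRing.Theory Num.Theory.
Import numFieldNormedType.Exports.

Local Open Scope classical_set_scope.
Local Open Scope ring_scope.

(* Taking the larger element of both sets gives ||T f + T g|| = ||f + g||.
   Testing against tall bumps, f <= g iff ||f + h|| <= ||g + h|| for all h, so
   T is an order isomorphism of the cones.  For a point x, the functions T h,
   with h of height M peaking at x, therefore all reach M at a common point y,
   and ||T f + T h|| = ||f + h|| with h concentrated near x gives
   T f y <= f x whenever f <= M.  The same for the inverse of T at y produces a
   point x' with f x' <= T f y <= f x, so x' = x and T f y = f x. *)

(** * The cone and its supremum norm *)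

Lemma C0_posD (L : topologicalType) (R : realType) (f g : L -> R) :
  C0_pos L R f -> C0_pos L R g -> C0_pos L R (f + g).
Proof.
move=> [[cf vf] f0] [[cg vg] g0]; split; last first.
  by move=> x; exact: addr_ge0.
split; first by move=> x; apply: cvgD; [exact: cf|exact: cg].
move=> e e0; have e20 : 0 < e / 2 by rewrite divr_gt0.
have [K cK Ke] := vf _ e20; have [K' cK' Ke'] := vg _ e20.
exists (K `|` K'); first exact: compactU.
move=> x /not_orP[/Ke h1 /Ke' h2]; rewrite (splitr e).
by apply: le_lt_trans (ler_normD _ _) _; exact: ltrD.
Qed.

Lemma sup_norm_empty (L : topologicalType) (R : realType) (u : L -> R) :
  ~ (exists x : L, True) -> sup_norm u = 0.
Proof.
move=> n; rewrite /sup_norm -[RHS](@sup0 R); congr sup.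
by rewrite -subset0 => r [x _ _]; apply: n; exists x.
Qed.

(** If [u z0 > 0], then [u < u z0] off some compact set, so the maximum over that set is global. If
    [u] is nowhere positive it is zero, and any point will do. *)
Lemma sup_norm_max {L : topologicalType} {R : realType} {u : L -> R} (x : L) :
  C0_pos L R u -> exists c, sup_norm u = u c /\ forall z, u z <= u c.
Proof.
move=> [[cu vu] u0].
have [c hc] : exists c, forall z, u z <= u c.
  have [[z0 uz0]|nz] := pselect (exists z0, 0 < u z0); last first.
    exists x => z; apply: le_trans (u0 x); rewrite leNgt; apply/negP => h.
    by apply: nz; exists z.
  have [K cK Ke] := vu _ uz0.
  have Kz0 : K z0.
    by apply: contrapT => /Ke; rewrite ger0_norm// ltxx.
  have [||c _ hc] := @compact_EVT_max _ _ u K _ cK.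
  - by exists z0.
  - exact: continuous_subspaceT.
  exists c => z; have [Kz|/Ke] := pselect (K z); first by apply: hc; rewrite inE.
  rewrite ger0_norm// => /ltW h; apply: le_trans h _; apply: hc.
  by rewrite inE.
exists c; split=> //; apply/eqP; rewrite eq_le; apply/andP; split.
  apply: ge_sup; first by exists `|u c|, c.
  by move=> _ [z _ <-]; rewrite ger0_norm.
apply: ub_le_sup; last by exists c; rewrite // ger0_norm.
by exists (u c) => _ [z _ <-]; rewrite ger0_norm.
Qed.

Lemma le_sup_norm {L : topologicalType} {R : realType} {u : L -> R} (x : L) :
  C0_pos L R u -> u x <= sup_norm u.
Proof. by move=> /(sup_norm_max x)[c [-> ?]]. Qed.

Lemma sup_norm_attained {L : topologicalType} {R : realType} {u : L -> R} :
  C0_pos L R u -> 0 < sup_norm u -> exists c, u c = sup_norm u.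
Proof.
move=> Cu u0; have [[x _]|n] := pselect (exists x : L, True).
  by have [c [-> _]] := sup_norm_max x Cu; exists c.
by rewrite sup_norm_empty ?ltxx in u0.
Qed.

(** Pointwise [|f - g| <= f + g] on the cone. This singles out the norm of the sum as the larger
    element of the pair in [phase_isometry]. *)
Lemma sup_normB_le {L : topologicalType} {R : realType} {f g : L -> R} :
  C0_pos L R f -> C0_pos L R g -> sup_norm (f - g) <= sup_norm (f + g).
Proof.
move=> Cf Cg; have [[x _]|n] := pselect (exists x : L, True); last first.
  by rewrite !sup_norm_empty.
apply: ge_sup; first by exists `|(f - g) x|, x.
move=> _ [z _ <-]; apply: le_trans (le_sup_norm z (C0_posD _ _ _ _ Cf Cg)).
apply: le_trans (ler_normB _ _) _.
by case: Cf Cg => _ f0 [_ g0]; rewrite !ger0_norm.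
Qed.

(** * Bump functions *)

(** Complete regularity yields a continuous [f] with values in [0, 1], equal to 0 at [x] and to 1
    off [U] intersected with a compact neighbourhood [K]. The bump [M * (1 - f)] vanishes off [K],
    hence at infinity. *)
Lemma C0_pos_bump {L : topologicalType} {R : realType} (x : L) (U : set L) (M : R) :
  locally_compact [set: L] -> hausdorff_space L -> nbhs x U -> 0 <= M ->
  exists b, [/\ C0_pos L R b, b x = M, forall z, b z <= M &
    forall z, ~ U z -> b z = 0].
Proof.
move=> lc hL nU M0.
have [K nK [cK _]] : exists2 K, nbhs x K & compact K /\ closed K.
  by have := lc x I; rewrite withinET.
pose B := ~` (U `&` K)^°.
have clB : closed B by apply: open_closedC; exact: open_interior.
have /(locally_compact_completely_regular (R := R) lc hL clB) /(uniform_separatorP (R := R)) [f [cf f01 fx fB]] : ~ B x.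
  by apply: contrapT => /contrapT []; apply: filterI.
have {}f01 z : 0 <= f z <= 1.
  by have := f01 (f z) (ex_intro2 _ _ z I erefl); rewrite /= in_itv.
have {}fx : f x = 0 by apply: fx; exists x.
have {}fB z : ~ (U `&` K) z -> f z = 1.
  move=> n; apply: fB; exists z => //= /interior_subset; exact: n.
have b0 z : 0 <= M * (1 - f z).
  by rewrite mulr_ge0// subr_ge0; case/andP: (f01 z).
exists (fun z => M * (1 - f z)); split.
- split => //; split.
    move=> z; apply: cvgM; first exact: cvg_cst.
    by apply: cvgB; [exact: cvg_cst|exact: cf].
  move=> e e0; exists K => // z nK'; rewrite fB; last by case.
  by rewrite subrr mulr0 normr0.
- by rewrite fx subr0 mulr1.
- by move=> z; rewrite ler_piMr// gerBl; case/andP: (f01 z).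
- by move=> z nU'; rewrite fB ?subrr ?mulr0// => -[].
Qed.

(* Adding a bump of height [M >= u] concentrated near [x] moves the maximum of
   [u] close to [x], so [sup_norm (u + h) - M] tends to [u x]. *)
Lemma sup_norm_add_bump {L : topologicalType} {R : realType} (x : L) (u : L -> R)
    (M e : R) :
  locally_compact [set: L] -> hausdorff_space L -> C0_pos L R u ->
  (forall z, u z <= M) -> 0 < e ->
  exists h, [/\ C0_pos L R h, h x = M, forall z, h z <= M &
    sup_norm (u + h) <= M + u x + e].
Proof.
move=> lc hL Cu uM e0; have u0 : forall z, 0 <= u z by case: Cu.
have nU : nbhs x [set z | u z < u x + e].
  case: Cu => [[cu _] _]; apply: (cvgr_lt (u x) (cu x)); rewrite ltrDl//.
have [h [Ch hx hM hU]] := C0_pos_bump x _ M lc hL nU (le_trans (u0 x) (uM x)).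
exists h; split => //.
have [c [-> _]] := sup_norm_max x (C0_posD _ _ _ _ Cu Ch).
have -> : (u + h) c = u c + h c by [].
have := uM c; have := hM c; have := u0 x.
(* Near [x], [u c <= u x + e] and [h c <= M]; elsewhere [h c = 0] and [u c <= M]. *)
have [/ltW|/hU ->] := pselect (u c < u x + e); lra.
Qed.

(** * Bijections preserving norms of sums, and their monotonicity *)

(** The inverse [S] is explicit so that the notion is symmetric: each result about [T] also serves
    [S]. *)
Definition norm_add_iso {X Y : topologicalType} {R : realType}
    (T : (X -> R) -> (Y -> R)) (S : (Y -> R) -> (X -> R)) : Prop :=
  [/\ forall f, C0_pos X R f -> C0_pos Y R (T f) /\ S (T f) = f,
      forall g, C0_pos Y R g -> C0_pos X R (S g) /\ T (S g) = g &
      forall f g, C0_pos X R f -> C0_pos X R g ->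
        sup_norm (T f + T g) = sup_norm (f + g)].

Lemma norm_add_isoC {X Y : topologicalType} {R : realType}
    {T : (X -> R) -> (Y -> R)} {S : (Y -> R) -> (X -> R)} :
  norm_add_iso T S -> norm_add_iso S T.
Proof.
move=> [TS ST N]; split=> // f g Cf Cg.
have [CSf Sf] := ST _ Cf; have [CSg Sg] := ST _ Cg.
by rewrite -N// Sf Sg.
Qed.

(** For a bump [h] of height [||g||] concentrated near [x], [f x + ||g|| <= ||f + h|| <= ||g + h||
    <= ||g|| + g x + e]. *)
Lemma sup_norm_add_le {L : topologicalType} {R : realType} {f g : L -> R} :
  locally_compact [set: L] -> hausdorff_space L ->
  C0_pos L R f -> C0_pos L R g ->
  (forall h, C0_pos L R h -> sup_norm (f + h) <= sup_norm (g + h)) ->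
  forall x, f x <= g x.
Proof.
move=> lc hL Cf Cg H x; apply/ler_addgt0Pr => e e0.
have [h [Ch hx hM hN]] := sup_norm_add_bump x g _ e lc hL Cg
  (fun z => le_sup_norm z Cg) e0.
have := le_trans (H h Ch) hN; have := le_sup_norm x (C0_posD _ _ _ _ Cf Ch).
have -> : (f + h) x = f x + h x by [].
rewrite hx; lra.
Qed.

(** Every test function on [Y] is [T (S h)], so the comparison of norms moves to [X], where it
    follows from [f <= g]. *)
Lemma norm_add_iso_mono {X Y : topologicalType} {R : realType}
    {T : (X -> R) -> (Y -> R)} {S : (Y -> R) -> (X -> R)} {f g : X -> R} :
  locally_compact [set: Y] -> hausdorff_space Y -> norm_add_iso T S ->
  C0_pos X R f -> C0_pos X R g ->
  (forall x, f x <= g x) -> forall y, T f y <= T g y.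
Proof.
move=> lcY hY [TS ST N] Cf Cg fg y; have [CTf _] := TS _ Cf.
have [CTg _] := TS _ Cg.
apply: sup_norm_add_le => // h /ST[CSh <-]; rewrite !N//.
have [[x _]|n] := pselect (exists x : X, True); last first.
  by rewrite !sup_norm_empty.
have [c [-> _]] := sup_norm_max x (C0_posD _ _ _ _ Cf CSh).
apply: le_trans (le_sup_norm c (C0_posD _ _ _ _ Cg CSh)).
by rewrite lerD2r.
Qed.

(* The sets [{T h >= M}], for [h] peaking at [x] with height [M], are nonempty
   and compact, and directed because [T] is monotone and such [h] are closed
   under minimum: they share a point [y]. *)
Lemma norm_add_iso_point_le {X Y : topologicalType} {R : realType}
    {T : (X -> R) -> (Y -> R)} {S : (Y -> R) -> (X -> R)} (x : X) (M : R) :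
  locally_compact [set: X] -> hausdorff_space X ->
  locally_compact [set: Y] -> hausdorff_space Y ->
  norm_add_iso T S -> 0 < M ->
  exists y, forall f, C0_pos X R f -> (forall z, f z <= M) -> T f y <= f x.
Proof.
move=> lcX hX lcY hY I0 M0; have [TS ST N] := I0.
pose D : set (X -> R) :=
  [set h | [/\ C0_pos X R h, h x = M & forall z, h z <= M]].
pose E h := [set y | M <= T h y].
have D0 : D !=set0.
  by have [h [? ? ? _]] := C0_pos_bump x _ M lcX hX filterT (ltW M0); exists h.
have EF : Filter (filter_from D E).
  apply: filter_from_filter => // h k [Ch hx hM] [Ck kx kM].
  have Cm : C0_pos X R (h \min k).
    case: Ch Ck => [[ch vh] h0] [[ck vk] k0]; split; last first.
      by move=> z /=; rewrite le_min h0 k0.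
    split; first by move=> z; apply: continuous_min; [exact: ch|exact: ck].
    move=> e /vh [K cK Ke]; exists K => // z /Ke; rewrite !ger0_norm//=.
      by rewrite gt_min => ->.
    by rewrite le_min h0 k0.
  exists (h \min k).
    split=> //=; first by rewrite hx kx minxx.
    by move=> z; rewrite ge_min hM.
  move=> y My; split; apply: le_trans My _;
    apply: (norm_add_iso_mono lcY hY I0) => // z /=;
    by rewrite ge_min lexx ?orbT.
have EP : ProperFilter (filter_from D E).
  apply: filter_from_proper => // h [Ch hx hM]; have [CTh _] := TS _ Ch.
  have hh := C0_posD _ _ _ _ CTh CTh.
  (* [T h] reaches [M] because [2M = 2 h x <= ||h + h|| = ||T h + T h||], and this norm is
     attained. *)
  have n2 : M + M <= sup_norm (T h + T h).
    by rewrite N//; have := le_sup_norm x (C0_posD _ _ _ _ Ch Ch); rewrite -{1 2}hx.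
  have [|y hy] := sup_norm_attained hh; first by lra.
  exists y; rewrite /E /=.
  by move: n2; rewrite -hy; have -> : (T h + T h) y = T h y + T h y by []; lra.
have [h0 Dh0] := D0; have [Ch0 _ _] := Dh0; have [[[cTh vTh] _] _] := TS _ Ch0.
have [K cK Ke] := vTh _ M0.
(* [T h0 < M] off [K], so [E h0] lies in [K] and the filter clusters at some [y] of [K]; each [E h]
   is closed, hence contains [y]. *)
have [|y [Ky cy]] := cK _ EP.
  exists h0 => // y; rewrite /E /= => My; apply: contrapT => /Ke.
  by rewrite ltNge (le_trans My)// ler_norm.
exists y => f Cf fM; apply/ler_addgt0Pr => e e0.
have [h [Ch hx hM hN]] := sup_norm_add_bump x f M e lcX hX Cf fM e0.
have [CTh _] := TS _ Ch; have [CTf _] := TS _ Cf.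
have Eh : M <= T h y.
  have clE : closed (E h).
    apply: (@preimage_closed _ _ (T h) [set r | M <= r]); last exact: closed_ge.
    by move=> z _; case: CTh => -[cT _] _; exact: cT.
  by apply: clE => V nV; apply: cy => //; exists h.
have := le_sup_norm y (C0_posD _ _ _ _ CTf CTh); rewrite N//.
have -> : (T f + T h) y = T f y + T h y by []; lra.
Qed.

(** * Equality of values at matched points *)

(** Otherwise a bump of height [M] at [x'] that vanishes at [x] violates the inequality. *)
Lemma C0_pos_separates {L : topologicalType} {R : realType} (M : R) (x x' : L) :
  locally_compact [set: L] -> hausdorff_space L -> 0 < M ->
  (forall f, C0_pos L R f -> (forall z, f z <= M) -> f x' <= f x) -> x = x'.
Proof.
move=> lc hL M0 H; apply: contrapT => n.
have nU : nbhs x' [set~ x].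
  apply: open_nbhs_nbhs; split; last by move=> /esym.
  exact/closed_openC/accessible_closed_set1/hausdorff_accessible.
have [b [Cb bx bM /(_ x) b0]] := C0_pos_bump x' _ M lc hL nU (ltW M0).
by have := H _ Cb bM; rewrite bx b0; [rewrite leNgt M0|apply].
Qed.

Lemma norm_add_iso_point_bounded {X Y : topologicalType} {R : realType}
    {T : (X -> R) -> (Y -> R)} {S : (Y -> R) -> (X -> R)} (x : X) (M : R) :
  locally_compact [set: X] -> hausdorff_space X ->
  locally_compact [set: Y] -> hausdorff_space Y ->
  norm_add_iso T S -> 0 < M ->
  exists y, forall f, C0_pos X R f -> (forall z, f z <= M) -> T f y = f x.
Proof.
move=> lcX hX lcY hY I0 M0.
have [y hy] := norm_add_iso_point_le x M lcX hX lcY hY I0 M0.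
have [x' hx'] := norm_add_iso_point_le y M lcY hY lcX hX (norm_add_isoC I0) M0.
have [TS ST N] := I0.
have H f : C0_pos X R f -> (forall z, f z <= M) -> f x' <= T f y.
  move=> Cf fM; have [CTf Sf] := TS _ Cf; rewrite -{1}Sf; apply: hx' => // z.
  (* The bound [M] passes to [T f]: [2 T f z <= ||T f + T f|| = ||f + f|| <= 2M]. *)
  have := le_sup_norm z (C0_posD _ _ _ _ CTf CTf); rewrite N//.
  have [c [-> _]] := sup_norm_max x (C0_posD _ _ _ _ Cf Cf).
  have -> : (T f + T f) z = T f z + T f z by [].
  have -> : (f + f) c = f c + f c by []; have := fM c; lra.
have xx' : x = x'.
  apply: (C0_pos_separates M _ _ lcX hX M0) => f Cf fM.
  exact: le_trans (H _ Cf fM) (hy _ Cf fM).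
exists y => f Cf fM; apply/eqP; rewrite eq_le hy//= {1}xx'; exact: H.
Qed.

(** The point found for the bound 1 serves every bound. If [y'] belongs to a larger bound and
    [g <= 1], then [S g <= 1], so [g y = S g x = g y'], and such [g] separate points. *)
Lemma norm_add_iso_point {X Y : topologicalType} {R : realType}
    {T : (X -> R) -> (Y -> R)} {S : (Y -> R) -> (X -> R)} (x : X) :
  locally_compact [set: X] -> hausdorff_space X ->
  locally_compact [set: Y] -> hausdorff_space Y ->
  norm_add_iso T S ->
  exists y, forall f, C0_pos X R f -> T f y = f x.
Proof.
move=> lcX hX lcY hY I0.
have [y hy] := norm_add_iso_point_bounded x 1 lcX hX lcY hY I0 ltr01.
exists y => f Cf.
have s0 : 0 <= sup_norm f.
  by apply: le_trans (le_sup_norm x Cf); case: Cf.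
(* Adding 1 keeps the bound positive when [f] is zero. *)
have [|y' hy'] := norm_add_iso_point_bounded x (sup_norm f + 1) lcX hX lcY hY I0.
  lra.
suff -> : y = y'.
  by apply: hy' => // z; have := le_sup_norm z Cf; lra.
have [TS ST N] := I0.
apply: (C0_pos_separates (1 : R) _ _ lcY hY ltr01) => g Cg g1; have [CSg <-] := ST _ Cg.
suff h z : S g z <= 1.
  by rewrite hy// hy'// => z; have := h z; lra.
have := le_sup_norm z (C0_posD _ _ _ _ CSg CSg).
have [_ _ ->//] := norm_add_isoC I0.
have [c [-> _]] := sup_norm_max y (C0_posD _ _ _ _ Cg Cg).
have -> : (S g + S g) z = S g z + S g z by [].
have -> : (g + g) c = g c + g c by []; have := g1 c; lra.
Qed.

(** * From the phase-isometry to the homeomorphism *)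

Lemma phase_isometry_iso {X Y : topologicalType} {R : realType}
    {T : (X -> R) -> (Y -> R)} :
  set_fun (C0_pos X R) (C0_pos Y R) T -> set_surj (C0_pos X R) (C0_pos Y R) T ->
  phase_isometry T ->
  locally_compact [set: X] -> hausdorff_space X ->
  exists S, norm_add_iso T S.
Proof.
move=> Tfun Tsurj Tph lcX hX.
have N f g : C0_pos X R f -> C0_pos X R g ->
    sup_norm (T f + T g) = sup_norm (f + g).
  move=> Cf Cg; have E := Tph f g Cf Cg.
  have le1 := sup_normB_le Cf Cg; have le2 := sup_normB_le (Tfun _ Cf) (Tfun _ Cg).
  apply/eqP; rewrite eq_le; apply/andP; split.
    have : [set sup_norm (f + g); sup_norm (f - g)] (sup_norm (T f + T g)).
      by rewrite -E; left.
    by case=> ->.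
  have : [set sup_norm (T f + T g); sup_norm (T f - T g)] (sup_norm (f + g)).
    by rewrite E; left.
  by case=> ->.
(* If [T f = T g], then [||f + h|| = ||g + h||] for all [h] in the cone, which gives both
   inequalities between [f] and [g]. *)
have inj f g : C0_pos X R f -> C0_pos X R g -> T f = T g -> f = g.
  move=> Cf Cg E; apply/funext => x; apply/eqP; rewrite eq_le; apply/andP; split.
    by apply: sup_norm_add_le => // h Ch; rewrite -!N// E.
  by apply: sup_norm_add_le => // h Ch; rewrite -!N// E.
have /choice[S HS] : forall g, exists f, C0_pos Y R g -> C0_pos X R f /\ T f = g.
  move=> g; have [/Tsurj[f Cf Tf]|n] := pselect (C0_pos Y R g).
    by exists f.
  by exists (fun=> 0).
exists S; split=> // f Cf; have CTf := Tfun _ Cf; split=> //.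
by have [CS TS] := HS _ CTf; exact: inj.
Qed.

(** For a bump [b] at [phi y] vanishing off [U], the open condition [0 < b (phi z)] forces [phi z]
    into [U]. *)
Lemma C0_pos_continuous {X Y : topologicalType} (R : realType) (phi : Y -> X) :
  locally_compact [set: X] -> hausdorff_space X ->
  (forall f, C0_pos X R f -> continuous (f \o phi)) -> continuous phi.
Proof.
move=> lcX hX H y U nU.
have [b [Cb bx bM b0]] := C0_pos_bump (phi y) U (1 : R) lcX hX nU ler01.
have : nbhs y [set z | 0 < b (phi z)].
  by apply: (cvgr_gt _ (H _ Cb y)); rewrite /= bx ltr01.
apply: filterS => z /= bz; apply: contrapT => /b0 h.
by rewrite h ltxx in bz.
Qed.

Theorem theorem1p1 (R : realType) (X Y : topologicalType)
    (lcX : locally_compact [set: X]) (hX : hausdorff_space X)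
    (lcY : locally_compact [set: Y]) (hY : hausdorff_space Y)
    (T : (X -> R) -> (Y -> R))
    (Tfun : set_fun (C0_pos X R) (C0_pos Y R) T)
    (Tsurj : set_surj (C0_pos X R) (C0_pos Y R) T)
    (Tphase : phase_isometry T) :
  exists phi : Y -> X, homeomorphism phi /\
    forall f, C0_pos X R f -> forall y, T f y = f (phi y).
Proof.
have [S I0] := phase_isometry_iso Tfun Tsurj Tphase lcX hX.
have I1 := norm_add_isoC I0; have [TS ST _] := I0.
have /choice[psi hpsi] := fun x => norm_add_iso_point x lcX hX lcY hY I0.
have /choice[phi hphi] := fun y => norm_add_iso_point y lcY hY lcX hX I1.
have Tphi f y : C0_pos X R f -> T f y = f (phi y).
  by move=> Cf; have [CTf Sf] := TS _ Cf; rewrite -hphi// Sf.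
have Spsi g x : C0_pos Y R g -> S g x = g (psi x).
  by move=> Cg; have [CSg Tg] := ST _ Cg; rewrite -hpsi// Tg.
exists phi; split; last by move=> f Cf y; exact: Tphi.
exists psi; split.
(* [g (psi (phi y)) = S g (phi y) = g y] for all [g] in the cone, which separates points. *)
- move=> y; apply: (C0_pos_separates (1 : R) _ _ lcY hY ltr01) => g Cg _.
  by rewrite -Spsi// hphi.
- move=> x; apply: (C0_pos_separates (1 : R) _ _ lcX hX ltr01) => f Cf _.
  by rewrite -Tphi// hpsi.
- apply: (C0_pos_continuous R phi lcX hX) => f Cf.
  rewrite (_ : f \o phi = T f); first by have [[[]]] := TS _ Cf.
  by apply/funext => y; rewrite Tphi.
- apply: (C0_pos_continuous R psi lcY hY) => g Cg.
  rewrite (_ : g \o psi = S g); first by have [[[]]] := ST _ Cg.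
  by apply/funext => x; rewrite Spsi.
Qed.
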